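(* Let $G$ be a connected finite simple graph with $\operatorname{im}(G)=t$, and suppose $G$ is not the complete graph $K_t$. Then for every $n\geq 5$, $\operatorname{im}(G\,\Box\, P_n)\geq t+2$.
   Context: All graphs are finite and simple. $P_n$ is the path on $n$ vertices. A graph $G$ has a $G'$-immersion if there is an injective map $\phi:V(G')\to V(G)$ such that for every edge $uv\in E(G')$ there is a path in $G$ joining $\phi(u)$ and $\phi(v)$, and these paths are pairwise edge-disjoint. The immersion number $\operatorname{im}(G)$ is the largest $t$ such that $G$ has a $K_t$-immersion. The Cartesian product $G\,\Box\, H$ has vertex set $V(G)\times V(H)$, with $(g,h)$ adjacent to $(g',h')$ iff $g=g'$ and $hh'\in E(H)$, or $gg'\in E(G)$ and $h=h'$. *)

(* Defs.v *)
From mathcomp Require Import all_boot.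
From mathcomp Require Import boolp.

Set Implicit Arguments.
Unset Strict Implicit.
Unset Printing Implicit Defensive.

Record sgraph := SGraph {
  vertex :> finType;
  adj : rel vertex;
  adj_sym : symmetric adj;
  adj_irrefl : irreflexive adj }.

Definition edges (G : sgraph) : {set {set G}} :=
  [set e | [exists x : G, exists y : G, adj x y && (e == [set x; y])]].

Definition connected (G : sgraph) : Prop :=
  (0 < #|G|) /\ (forall x y : G, connect (@adj G) x y).

Definition isomorphic (G H : sgraph) : Prop :=
  exists f : G -> H, bijective f /\ (forall x y, adj (f x) (f y) = adj x y).

Section Complete.
Variable t : nat.
Definition complete_adj : rel 'I_t := fun i j => i != j.
Lemma complete_adj_sym : symmetric complete_adj.
Proof. by move=> i j; rewrite /complete_adj eq_sym. Qed.
Lemma complete_adj_irrefl : irreflexive complete_adj.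
Proof. by move=> i; rewrite /complete_adj eqxx. Qed.
Definition complete_graph := SGraph complete_adj_sym complete_adj_irrefl.
End Complete.

Section Path.
Variable n : nat.
Definition path_adj : rel 'I_n :=
  fun i j => (i.+1 == j :> nat) || (j.+1 == i :> nat).
Lemma path_adj_sym : symmetric path_adj.
Proof. by move=> i j; rewrite /path_adj orbC. Qed.
Lemma path_adj_irrefl : irreflexive path_adj.
Proof. by move=> i; rewrite /path_adj orbb eqn_leq ltnn. Qed.
Definition path_graph := SGraph path_adj_sym path_adj_irrefl.
End Path.

Section CartesianProduct.
Variables G H : sgraph.
Definition cart_adj : rel (G * H)%type := fun p q =>
  ((p.1 == q.1) && adj p.2 q.2) || (adj p.1 q.1 && (p.2 == q.2)).
Lemma cart_adj_sym : symmetric cart_adj.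
Proof.
by move=> p q; rewrite /cart_adj !(adj_sym p.1, adj_sym p.2) !(eq_sym _ (q.1), eq_sym _ (q.2)).
Qed.
Lemma cart_adj_irrefl : irreflexive cart_adj.
Proof. by move=> p; rewrite /cart_adj !adj_irrefl andbF. Qed.
Definition cart_prod := SGraph cart_adj_sym cart_adj_irrefl.
End CartesianProduct.

(* A path is the sequence of its vertices, without repetition; it joins its
   two ends in either order, as edges are unordered. *)
Definition joins (G : sgraph) (p : seq G) (a b : G) : bool :=
  if p is x :: s then
    [&& path (@adj G) x s, uniq p &
        ((x == a) && (last x s == b)) || ((x == b) && (last x s == a))]
  else false.

Definition path_edges (G : sgraph) (p : seq G) : seq {set G} :=
  if p is x :: s then pairmap (fun y z => [set y; z]) x s else [::].

(* [G] has an [H]-immersion. The paths are indexed by the unordered edges of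
   [H], so that each edge of [H] gets exactly one path; the values of [P]
   outside [edges H] are irrelevant. *)
Definition has_immersion (H G : sgraph) : Prop :=
  exists (phi : H -> G) (P : {set H} -> seq G),
    [/\ injective phi,
        forall u v : H, adj u v -> joins (P [set u; v]) (phi u) (phi v)
      & forall e f : {set H}, e \in edges H -> f \in edges H -> e != f ->
          [disjoint path_edges (P e) & path_edges (P f)]].

(* By injectivity of the vertex map, only t <= #|G| can occur, so that this
   is the largest t such that [G] has a K_t-immersion: see
   [immersion_numberP]. *)
Definition immersion_number (G : sgraph) : nat :=
  \max_(t < #|G|.+1 | `[< has_immersion (complete_graph t) G >]) t.

Lemma has_immersion_card (t : nat) (G : sgraph) :
  has_immersion (complete_graph t) G -> t <= #|G|.
Proof.
by case=> phi [P [phi_inj _ _]]; rewrite -[t]card_ord; apply: (leq_card phi).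
Qed.

Lemma has_immersion_K0 (G : sgraph) : has_immersion (complete_graph 0) G.
Proof.
exists (fun i : 'I_0 => match notF (ltn_ord i) with end), (fun=> [::]).
split; [by case | by case | move=> e f].
by rewrite inE => /existsP[[]].
Qed.

Lemma immersion_numberP (G : sgraph) :
  has_immersion (complete_graph (immersion_number G)) G /\
  (forall t, has_immersion (complete_graph t) G -> t <= immersion_number G).
Proof.
split=> [|t tG].
  rewrite /immersion_number.
  have K0 : `[< has_immersion (complete_graph (@ord0 #|G|)) G >].
    by apply/asboolP; exact: has_immersion_K0.
  by rewrite (bigmax_eq_arg _ K0); case: arg_maxnP => // i /asboolP.
have t_lt : t < #|G|.+1 by rewrite ltnS; exact: has_immersion_card.
apply: (leq_bigmax_cond (F := fun i : 'I__ => i : nat) (Ordinal t_lt)).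
exact/asboolP.
Qed.

(* Main.v *)
Require Import Defs.
From mathcomp Require Import all_boot.

(** Count edges: a graph on [t] vertices immersing [K_t] has at least ['C(t, 2)]
    edges, so it is [K_t]; hence [G] has a vertex [w] that is not a terminal of
    its [K_t]-immersion.  In [G [] P_n], number the layers from 0.  Keep the [t]
    terminals in layer 2, fix one of them, [v], and add the new terminals
    [a = (v, 1)] and [b = (v, 3)].  Paths between old terminals stay in layer 2.
    The path from [a] to an old terminal [x] follows the copy in layer 1 of the
    [v]-[x] path and then the vertical edge at [x]; symmetrically for [b] with
    layer 3.  The [a]-[b] path goes down to layer 0, across to [w], up along
    the column of [w] to layer 4, and back to [v].
    Edge-disjointness is handled by colouring the edges of the host graph with
    unordered pairs of terminals: the path for a pair may only use the edges of
    that colour. *)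

Set Implicit Arguments.
Unset Strict Implicit.
Unset Printing Implicit Defensive.

(** * Connectivity, unordered pairs and edges of paths *)

Lemma homo_connect (T U : finType) (e : rel T) (e' : rel U) (f : T -> U) :
  {homo f : x y / e x y >-> e' x y} ->
  {homo f : x y / connect e x y >-> connect e' x y}.
Proof.
move=> ef x y /connectP[p p_path ->]; apply/connectP; exists (map f p).
  exact: homo_path p_path.
by rewrite last_map.
Qed.

Lemma eq_set2 (T : finType) (x y x' y' : T) : [set x; y] = [set x'; y'] ->
  (x = x' /\ y = y') \/ (x = y' /\ y = x').
Proof.
move=> xy_eq.
have: x \in [set x'; y'] by rewrite -xy_eq set21.
have: y \in [set x'; y'] by rewrite -xy_eq set22.
have: x' \in [set x; y] by rewrite xy_eq set21.
have: y' \in [set x; y] by rewrite xy_eq set22.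
by do 4![case/set2P=> ?]; subst; auto.
Qed.

Lemma mem_edges (G : sgraph) (x y : G) : adj x y -> [set x; y] \in edges G.
Proof.
move=> xy; rewrite inE; apply/existsP; exists x; apply/existsP; exists y.
by rewrite xy /=.
Qed.

(** Turns a condition on the edges of a path into a restriction of the adjacency relation, the form
    in which [connect] can handle it. *)
Lemma path_edges_all (G : sgraph) (D : pred {set G}) (x : G) (s : seq G) :
  path [rel y z | adj y z && D [set y; z]] x s
    = path (@adj G) x s && all D (path_edges (x :: s)).
Proof.
elim: s x => //= y s IHs x; rewrite IHs /= -!andbA; congr andb.
by rewrite andbCA.
Qed.

(** * Immersions as edge colourings *)

Definition color_rel (G : sgraph) (C : eqType) (c : G -> G -> C) (k : C) :
  rel G := [rel x y | adj x y && (c x y == k)].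

Lemma color_connect_sym (G : sgraph) (C : eqType) (c : G -> G -> C) (k : C) :
  (forall x y, adj x y -> c x y = c y x) -> connect_sym (color_rel c k).
Proof.
move=> c_sym; apply: sym_connect_sym => x y; rewrite /color_rel /= adj_sym.
by case: (boolP (adj y x)) => //= yx; rewrite (c_sym _ _ yx).
Qed.

(** Connectivity within colour [e] yields a path for [e] with all its edges of that colour. As [c]
    is symmetric on edges, an edge has only one colour, so paths for different [e] share no edge. *)
Lemma color_immersion (H G : sgraph) (phi : H -> G) (c : G -> G -> {set H}) :
    injective phi -> (forall x y, adj x y -> c x y = c y x) ->
    (forall u v, adj u v -> connect (color_rel c [set u; v]) (phi u) (phi v)) ->
  has_immersion H G.
Proof.
move=> phi_inj c_sym phi_connect.
pose colored e (A : {set G}) :=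
  [exists x, exists y, [&& A == [set x; y], adj x y & c x y == e]].
pose good e p := all (colored e) (path_edges p) &&
  (* The set [e] does not order its ends, so the path must serve both orders. *)
  [forall u, forall v, (adj u v && (e == [set u; v])) ==>
                         joins p (phi u) (phi v)].
have goodP e : e \in edges H -> exists p, good e p.
  rewrite inE => /existsP[u /existsP[v /andP[uv /eqP->]]].
  have /connectP[s s_path s_last] := phi_connect u v uv.
  case/shortenP: s_path s_last => p p_path p_uniq _ p_last.
  exists (phi u :: p); have : path [rel y z | adj y z &&
      colored [set u; v] [set y; z]] (phi u) p.
    apply: sub_path p_path => y z /= /andP[yz cyz]; rewrite yz.
    by apply/existsP; exists y; apply/existsP; exists z; rewrite eqxx yz.
  rewrite path_edges_all /good => /andP[p_adj ->].
  apply/forallP=> u'; apply/forallP=> v'; apply/implyP=> /andP[u'v' /eqP uv_eq].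
  rewrite /joins p_adj p_uniq -p_last.
  by case: (eq_set2 uv_eq) => -[-> ->]; rewrite !eqxx ?orbT.
(* Matching on [idP] supplies the membership proof that [xchoose] needs; the empty default outside
   [edges H] is irrelevant. *)
pose P e := if @idP (e \in edges H) is ReflectT eH
            then xchoose (goodP e eH) else [::].
have PP e : e \in edges H -> good e (P e).
  by rewrite /P; case: {-}_ / idP => // eH _; apply: xchooseP.
exists phi, P; split=> // [u v uv|e f eH fH ef].
  have /andP[_ /forallP/(_ u)/forallP/(_ v)] := PP _ (mem_edges uv).
  by rewrite uv eqxx.
have /andP[/allP eP _] := PP _ eH; have /andP[/allP fP _] := PP _ fH.
apply/pred0P=> A; apply/negP=> /andP[/= /eP Ae /fP].
case/existsP: Ae => x /existsP[y /and3P[/eqP-> xy /eqP xye]].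
case/existsP=> x' /existsP[y' /and3P[/eqP xy_eq _ /eqP xyf]].
case/eqP: ef; rewrite -xye -xyf.
by case: (eq_set2 xy_eq) => -[<- <-] //; exact: c_sym.
Qed.

(** Allows terminals indexed by any finite type, so that two new ones can be added with [option]. *)
Lemma color_immersion_complete (T : finType) (G : sgraph) (phi : T -> G)
    (c : G -> G -> {set T}) :
    injective phi -> (forall x y, adj x y -> c x y = c y x) ->
    (forall u v, u != v -> connect (color_rel c [set u; v]) (phi u) (phi v)) ->
  has_immersion (complete_graph #|T|) G.
Proof.
move=> phi_inj c_sym phi_connect.
apply: (@color_immersion (complete_graph #|T|) G (phi \o enum_val)
         (fun x y => enum_rank @: c x y)).
- by apply: inj_comp phi_inj _; exact: enum_val_inj.
- by move=> x y xy; rewrite c_sym.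
move=> u v uv.
have /phi_connect : enum_val u != enum_val v by rewrite (inj_eq enum_val_inj).
apply: connect_sub => x y /andP[xy /eqP cxy]; apply: connect1.
by rewrite /color_rel /= xy cxy imsetU !imset_set1 !enum_valK eqxx.
Qed.

(** Colour each edge by the pair whose path contains it; disjointness of the paths makes this pair
    unique. Edges on no path get [set0]. *)
Lemma immersion_color (H G : sgraph) : has_immersion H G ->
  exists (phi : H -> G) (c : G -> G -> {set H}),
    [/\ injective phi, forall x y, adj x y -> c x y = c y x &
        forall u v, adj u v ->
          connect (color_rel c [set u; v]) (phi u) (phi v)].
Proof.
case=> phi [P [phi_inj P_joins P_disj]].
pose c (x y : G) :=
  odflt set0 [pick e in edges H | [set x; y] \in path_edges (P e)].
have c_sym x y : c x y = c y x by rewrite /c setUC.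
exists phi, c; split=> // u v uv; set e := [set u; v].
have eH : e \in edges H by exact: mem_edges.
have cE x y : [set x; y] \in path_edges (P e) -> c x y = e.
  move=> xy; rewrite /c; case: pickP => [f /andP[fH fxy]|/(_ e)]; last first.
    by rewrite /= eH xy.
  apply/eqP/negPn/negP => fe.
  have /pred0P/(_ [set x; y]) := P_disj _ _ fH eH fe.
  by rewrite /= fxy xy.
have := P_joins _ _ uv; rewrite -/e /joins.
case: (P e) cE => // x s cE /and3P[s_path _ s_ends].
have {s_path}xs : connect (color_rel c e) x (last x s).
  apply/connectP; exists s => //.
  have : path [rel y z | adj y z && ([set y; z] \in path_edges (x :: s))] x s.
    by rewrite path_edges_all s_path; apply/allP.
  apply: sub_path => y z; rewrite /color_rel /= => /andP[-> /cE->].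
  by rewrite eqxx.
case/orP: s_ends => /andP[/eqP<- /eqP<-] //.
by rewrite color_connect_sym.
Qed.

(** * Counting edges *)

(** Sending an edge of [G] to its colour hits every edge of [H], since each colour class joins two
    distinct vertices and so is nonempty. *)
Lemma immersion_card_edges (H G : sgraph) :
  has_immersion H G -> #|edges H| <= #|edges G|.
Proof.
case/immersion_color=> phi [c [phi_inj c_sym phi_connect]].
pose f (A : {set G}) := odflt set0 [pick k |
  [exists x, exists y, [&& A == [set x; y], adj x y & c x y == k]]].
suff /subset_leq_card HG : edges H \subset f @: edges G.
  exact: leq_trans HG (leq_imset_card _ _).
apply/subsetP=> e; rewrite inE => /existsP[u /existsP[v /andP[uv /eqP->]]].
(* The empty path is excluded by injectivity of [phi]; otherwise the first edge has the wanted
   colour. *)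
have /connectP[[|y s] /=] := phi_connect _ _ uv.
  by move=> _ /phi_inj vu; rewrite vu adj_irrefl in uv.
set x := phi u => /andP[/andP[xy /eqP cxy] _] _.
apply/imsetP; exists [set x; y]; first exact: mem_edges.
rewrite /f; case: pickP => [k|/(_ [set u; v])/negbT/negP[]]; last first.
  by apply/existsP; exists x; apply/existsP; exists y; rewrite eqxx xy cxy /=.
case/existsP=> x' /existsP[y' /and3P[/eqP xy_eq x'y' /eqP<-]] /=.
by rewrite -cxy; case: (eq_set2 xy_eq) => -[<- <-] //; exact: c_sym.
Qed.

Lemma edges_sub_pairs (G : sgraph) :
  edges G \subset [set A : {set G} | #|A| == 2].
Proof.
apply/subsetP=> A; rewrite !inE => /existsP[x /existsP[y /andP[xy /eqP->]]].
by rewrite cards2; case: (x =P y) xy => // ->; rewrite adj_irrefl.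
Qed.

Lemma edges_complete (t : nat) :
  edges (complete_graph t) = [set A : {set 'I_t} | #|A| == 2].
Proof.
apply/eqP; rewrite eqEsubset edges_sub_pairs /=; apply/subsetP=> A.
rewrite !inE => /cards2P[x [y [xy ->]]].
by apply/existsP; exists x; apply/existsP; exists y; rewrite eqxx andbT.
Qed.

(** The edge count forces every pair of vertices of [G] to be an edge. *)
Lemma immersion_complete_isomorphic (G : sgraph) :
  has_immersion (complete_graph #|G|) G -> isomorphic G (complete_graph #|G|).
Proof.
move/immersion_card_edges.
rewrite edges_complete card_draws card_ord -card_draws.
move=> le_card; have /eqP edgesE : edges G == [set A : {set G} | #|A| == 2].
  by rewrite eqEcard edges_sub_pairs.
exists enum_rank; split; first exact: enum_rank_bij.
move=> x y; rewrite /= /complete_adj (inj_eq enum_rank_inj).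
case: eqVneq => [->|xy]; first by rewrite adj_irrefl.
have : [set x; y] \in edges G by rewrite edgesE inE cards2 xy.
rewrite inE => /existsP[x' /existsP[y' /andP[x'y' /eqP xy_eq]]].
by case: (eq_set2 xy_eq) => -[-> ->] //; rewrite adj_sym.
Qed.

Lemma immersion_number_gt0 (G : sgraph) : 0 < #|G| -> 0 < immersion_number G.
Proof.
case/card_gt0P=> x _; apply: (proj2 (immersion_numberP G)).
rewrite -card_unit.
apply: (@color_immersion_complete unit G (fun=> x) (fun _ _ => set0)) => //.
  by move=> [] [].
Qed.

(** * The colouring of the product *)

Section ProductColoring.

Variables (G : sgraph) (t m : nat).
Variables (phi : 'I_t -> G) (c : G -> G -> {set 'I_t}) (i0 : 'I_t) (w : G).
Hypothesis phi_inj : injective phi.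
Hypothesis c_sym : forall x y, adj x y -> c x y = c y x.
Hypothesis phi_connect : forall i j, i != j ->
  connect (color_rel c [set i; j]) (phi i) (phi j).
Hypothesis G_connect : forall x y : G, connect (@adj G) x y.
Hypothesis w_fresh : forall i, phi i != w.

Local Notation GP := (cart_prod G (path_graph m.+4.+1)).
Local Notation T := (option (option 'I_t)).
Local Notation a := (None : T).
Local Notation b := (Some None : T).
Local Notation old i := (Some (Some i) : T).

(** Layers are named by plain numbers; [inord] is faithful under the bound [k < 5] carried by the
    lemmas below. *)
Definition layer (k : nat) (x : G) : GP := (x, inord k).

Definition terminal (u : T) : GP :=
  match u with
  | None => layer 1 (phi i0)
  | Some None => layer 3 (phi i0)
  | Some (Some i) => layer 2 (phi i)
  end.

(** In its own layer the new terminal [u] takes over the role of [i0]. Pairs avoiding [i0] keep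
    their colour, which is harmless: extra edges only enlarge a colour class. *)
Definition relabel (u : T) (i : 'I_t) : T := if i == i0 then u else old i.

(** Names the old terminal that is reached from [a] or [b] along the vertical edge at [x]. *)
Definition label (u : T) (x : G) : T :=
  if [pick i | phi i == x] is Some i then old i else u.

(* The default value [b] (resp. [a]) of [label] gives the vertical edges of the
   column of [w] the colour [[set a; b]]. *)
Definition product_color (p q : GP) : {set T} :=
  let k := minn p.2 q.2 in
  if p.2 == q.2 then
    if k == 1 then relabel a @: c p.1 q.1
    else if k == 2 then (fun i => old i) @: c p.1 q.1
    else if k == 3 then relabel b @: c p.1 q.1
    else [set a; b]
  else if k == 1 then [set a; label b p.1]
  else if k == 2 then [set b; label a p.1]
  else [set a; b].

Lemma product_color_sym p q :
  adj p q -> product_color p q = product_color q p.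
Proof.
rewrite /product_color minnC (eq_sym q.2) /= /cart_adj.
case: (p.2 =P q.2) => [->|_]; last by rewrite andbF orbF => /andP[/eqP->].
by rewrite adj_irrefl andbF andbT => pq; rewrite (c_sym pq).
Qed.

Local Notation joined k := (connect (color_rel product_color k)).

Lemma joined_sym k : connect_sym (color_rel product_color k).
Proof. exact: color_connect_sym product_color_sym. Qed.

Lemma layer_val k x : k < 5 -> (layer k x).2 = k :> nat.
Proof. by move=> k5; rewrite inordK //; exact: leq_trans k5 _. Qed.

Lemma layer_color k x y : k < 5 -> product_color (layer k x) (layer k y) =
    if k == 1 then relabel a @: c x y
    else if k == 2 then (fun i => old i) @: c x y
    else if k == 3 then relabel b @: c x y
    else [set a; b].
Proof. by move=> k5; rewrite /product_color eqxx minnn layer_val. Qed.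

Lemma layer_adj k x y : adj x y -> adj (layer k x) (layer k y).
Proof. by move=> xy; rewrite /= /cart_adj /= xy eqxx orbT. Qed.

Lemma layer_joined (e : rel G) k (d : {set T}) x y : k < 5 ->
    (forall x' y', e x' y' ->
       adj x' y' /\ product_color (layer k x') (layer k y') = d) ->
  connect e x y -> joined d (layer k x) (layer k y).
Proof.
move=> k5 e_color; apply: homo_connect => {}x {}y /e_color[xy xyd].
by apply/andP; rewrite layer_adj // xyd.
Qed.

Lemma vertical_joined k x (d : {set T}) : k < 4 ->
    d = (if k == 1 then [set a; label b x]
         else if k == 2 then [set b; label a x] else [set a; b]) ->
  joined d (layer k x) (layer k.+1 x).
Proof.
move=> k4 ->; apply/connect1/andP; split.
  by rewrite /= /cart_adj /= eqxx /path_adj !layer_val ?eqxx // ltnW.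
have k5 : k < 5 := leqW k4.
have neq : ((layer k x).2 == (layer k.+1 x).2) = false.
  apply/negbTE/eqP=> /(congr1 (@nat_of_ord _)) /eqP.
  by rewrite !layer_val // ltn_eqF.
by rewrite /product_color neq !layer_val // (minn_idPl (leqnSn k)).
Qed.

Lemma label_phi u i : label u (phi i) = old i.
Proof.
rewrite /label; case: pickP => [j /eqP/phi_inj-> //|/(_ i)].
by rewrite eqxx.
Qed.

Lemma label_w u : label u w = u.
Proof.
by rewrite /label; case: pickP => // i; rewrite (negPf (w_fresh i)).
Qed.

Lemma relabel_pair u i : i != i0 -> relabel u @: [set i0; i] = [set u; old i].
Proof. by move=> ii0; rewrite imsetU !imset_set1 /relabel eqxx (negPf ii0). Qed.

Lemma joined_ab : joined [set a; b] (terminal a) (terminal b).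
Proof.
have across k x y : (k == 0) || (k == 4) ->
    joined [set a; b] (layer k x) (layer k y).
  move=> k04; have k5 : k < 5 by case/orP: k04 => /eqP->.
  apply: layer_joined k5 _ (G_connect x y) => x' y' x'y'; split=> //.
  by rewrite layer_color //; case/orP: k04 => /eqP->.
have down : joined [set a; b] (terminal a) (layer 0 w).
  apply: connect_trans (across 0 (phi i0) w isT); rewrite joined_sym.
  exact: vertical_joined.
(* No path from [a] or [b] to an old terminal uses the column of [w], as [w] is not a terminal. *)
have up : joined [set a; b] (layer 0 w) (layer 4 w).
  apply: (@connect_trans _ _ (layer 1 w)); first exact: vertical_joined.
  apply: (@connect_trans _ _ (layer 2 w)).
    by apply: vertical_joined => //=; rewrite label_w.
  apply: (@connect_trans _ _ (layer 3 w)); last exact: vertical_joined.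
  by apply: vertical_joined => //=; rewrite label_w setUC.
apply: connect_trans down (connect_trans up _).
apply: connect_trans (across 4 w (phi i0) isT) _; rewrite joined_sym.
exact: vertical_joined.
Qed.

Lemma joined_a i : joined [set a; old i] (terminal a) (terminal (old i)).
Proof.
have climb : joined [set a; old i] (layer 1 (phi i)) (layer 2 (phi i)).
  by apply: vertical_joined => //=; rewrite label_phi.
(* For [i = i0] both terminals lie in one column, and the vertical edge is the whole path. *)
have [ii0|ii0] := eqVneq i i0; first by rewrite /terminal -ii0.
apply: connect_trans climb.
rewrite eq_sym in ii0; apply: layer_joined (phi_connect ii0) => // x y.
case/andP=> xy /eqP cxy; split=> //.
by rewrite layer_color //= cxy relabel_pair // eq_sym.
Qed.

Lemma joined_b i : joined [set b; old i] (terminal b) (terminal (old i)).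
Proof.
have climb : joined [set b; old i] (layer 3 (phi i)) (layer 2 (phi i)).
  by rewrite joined_sym; apply: vertical_joined => //=; rewrite label_phi.
have [ii0|ii0] := eqVneq i i0; first by rewrite /terminal -ii0.
apply: connect_trans climb.
rewrite eq_sym in ii0; apply: layer_joined (phi_connect ii0) => // x y.
case/andP=> xy /eqP cxy; split=> //.
by rewrite layer_color //= cxy relabel_pair // eq_sym.
Qed.

Lemma joined_old i j : i != j ->
  joined [set old i; old j] (terminal (old i)) (terminal (old j)).
Proof.
move=> ij; apply: layer_joined (phi_connect ij) => // x y.
case/andP=> xy /eqP cxy; split=> //.
by rewrite layer_color //= cxy imsetU !imset_set1.
Qed.

Lemma terminal_inj : injective terminal.
Proof.
have layer_inj k l x y : k < 5 -> l < 5 -> layer k x = layer l y ->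
    k = l /\ x = y.
  move=> k5 l5 kl; split; last by case: kl.
  by rewrite -(layer_val x k5) kl layer_val.
move=> [[i|]|] [[j|]|] //= /layer_inj[] // _ /phi_inj-> //.
Qed.

Lemma product_immersion : has_immersion (complete_graph (t + 2)) GP.
Proof.
have -> : t + 2 = #|{: T}| by rewrite !card_option card_ord addn2.
apply: color_immersion_complete terminal_inj product_color_sym _.
move=> [[i|]|] [[j|]|] //= uv.
- by apply: joined_old; apply: contraNneq uv => ->.
- by rewrite setUC joined_sym; exact: joined_b.
- by rewrite setUC joined_sym; exact: joined_a.
- exact: joined_b.
- by rewrite setUC joined_sym; exact: joined_ab.
- exact: joined_a.
- exact: joined_ab.
Qed.

End ProductColoring.

(** * Choice of the fresh vertex and conclusion *)

Theorem theorem11 (G : sgraph) (t : nat)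
    (G_connected : connected G)
    (im_G : immersion_number G = t)
    (G_not_Kt : ~ isomorphic G (complete_graph t))
    (n : nat) (n_ge5 : 5 <= n) :
  t + 2 <= immersion_number (cart_prod G (path_graph n)).
Proof.
case: G_connected => G_gt0 G_connect.
(* Provides an old terminal to play the role of [i0]. *)
have t_gt0 : 0 < t by rewrite -im_G immersion_number_gt0.
have [Kt _] := immersion_numberP G; rewrite im_G in Kt.
have t_lt : t < #|G|.
  rewrite ltn_neqAle has_immersion_card // andbT.
  apply/eqP=> tG; apply: G_not_Kt; rewrite tG in Kt *.
  exact: immersion_complete_isomorphic.
have [phi [c [phi_inj c_sym phi_connect]]] := immersion_color Kt.
have [w w_fresh] : exists w, w \notin codom phi.
  apply/existsP; rewrite -negb_forall.
  apply: contraTN t_lt => /forallP phi_onto.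
  rewrite -leqNgt -[X in _ <= X](card_ord t) -(card_codom phi_inj).
  by apply/subset_leq_card/subsetP=> x _; exact: phi_onto.
(* Writes [n] as [m.+4.+1], so that layers 0 to 4 exist. *)
case: n n_ge5 => [|[|[|[|[|m]]]]] // _.
apply: (proj2 (immersion_numberP _)).
apply: (@product_immersion G t m phi c (Ordinal t_gt0) w) => //.
by move=> i; apply: contraNneq w_fresh => <-; exact: codom_f.
Qed.
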